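(* Let $S$ be a numerical semigroup, let $\{s,s+1\}\subseteq S$, and let $T=2S\cup(\{2s+1\}+2S)$. If $S$ verifies Wilf's conjecture, i.e. $g(S)\leq(e(S)-1)\,n(S)$, then $T$ also verifies it, i.e. $g(T)\leq(e(T)-1)\,n(T)$.
   Context: $\mathbb{N}=\{0,1,2,\ldots\}$. A numerical semigroup is a subset of $\mathbb{N}$ containing $0$, closed under addition and with finite complement in $\mathbb{N}$. For a numerical semigroup $S$: $F(S)=\max(\mathbb{Z}\setminus S)$ (so $F(\mathbb{N})=-1$); $g(S)$ is the cardinality of $\mathbb{N}\setminus S$; $e(S)$ is the cardinality of the (unique, finite) minimal system of generators of $S$ as a submonoid of $(\mathbb{N},+)$; $n(S)$ is the cardinality of $\{x\in S\mid x<F(S)\}$, so that $F(S)+1=g(S)+n(S)$. Notation: $2S=\{2x\mid x\in S\}$ and $A+B=\{a+b\mid a\in A,\ b\in B\}$. $T$ is a numerical semigroup. *)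

(* Defs.v *)
From mathcomp Require Import all_boot all_order all_algebra finmap.
From mathcomp Require Import boolp classical_sets functions cardinality.

Set Implicit Arguments.
Unset Strict Implicit.
Unset Printing Implicit Defensive.

Import Order.TTheory GRing.Theory Num.Theory.

Local Open Scope classical_set_scope.

Definition is_submonoid (M : set nat) : Prop :=
  M 0 /\ forall x y, M x -> M y -> M (x + y).

Definition numerical_semigroup (S : set nat) : Prop :=
  is_submonoid S /\ finite_set (~` S).

(* Only meaningful for finite sets: [fset_set] sends an infinite set to the
   empty one. *)
Definition cardinality (T : choiceType) (A : set T) : nat :=
  #|` fset_set A |%fset.

(* The complement is taken in [int], so that the Frobenius number of the full
   semigroup is -1; the default value of [xget] is never used for a numerical
   semigroup. *)
Definition int_gaps (S : set nat) : set int := ~` (Posz @` S).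

Definition frobenius (S : set nat) : int :=
  @xget int 0%R (int_gaps S `&` ubound (int_gaps S)).

Definition genus (S : set nat) : nat := cardinality (~` S).

Definition generated (A : set nat) : set nat := smallest is_submonoid A.

Definition system_of_generators (S A : set nat) : Prop := generated A = S.

Definition minimal_system_of_generators (S A : set nat) : Prop :=
  system_of_generators S A /\
  forall B, B `<=` A -> system_of_generators S B -> B = A.

(* For a numerical semigroup the minimal system of generators exists and is
   unique and finite, so [xget] selects it. *)
Definition embedding_dimension (S : set nat) : nat :=
  cardinality (xget set0 [set A | minimal_system_of_generators S A]).

Definition small_elements_number (S : set nat) : nat :=
  cardinality [set x | S x /\ (x%:Z < frobenius S)%R].

(* Stated in [int], where the subtraction is not truncated. *)
Definition wilf (S : set nat) : Prop :=
  ((genus S)%:Z <=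
   ((embedding_dimension S)%:Z - 1) * (small_elements_number S)%:Z)%R.

Definition dilate (k : nat) (S : set nat) : set nat := [set k * x | x in S].

Definition sumset (A B : set nat) : set nat := [set a + b | a in A & b in B].

(* Main.v *)
(** For [s > 0] the invariants of [T] are read off those of [S]: splitting [T] by parity gives
    [g(T) = 2 g(S) + s] and [F(T) + 1 = 2 (F(S) + 1) + 2 s], hence [n(T) = 2 n(S) + s];
    moreover [2 s + 1] and the doubles of the minimal generators of [S] are irreducible in [T],
    so [e(T) >= e(S) + 1].  Then
    [2 g(S) + s <= 2 (e(S) - 1) n(S) + s <= e(S) (2 n(S) + s)].
    For [s = 0] both semigroups are the whole of [nat]. *)
Require Import Defs.
From mathcomp Require Import all_boot all_order all_algebra finmap.
From mathcomp Require Import boolp classical_sets functions cardinality.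
From mathcomp Require Import zify.

Local Open Scope classical_set_scope.

(** * Cardinalities as sums of indicators *)

Lemma cardinality_sum (A : set nat) (N : nat) :
  (forall x, A x -> x < N) -> cardinality A = \sum_(0 <= i < N) `[< A i >].
Proof.
move=> AN; rewrite /cardinality.
have -> : fset_set A = [fset x in [seq x <- iota 0 N | `[< A x >]]]%fset.
  apply/fsetP => x; rewrite in_fset_set.
    rewrite !inE mem_filter mem_iota /= add0n.
    by apply/idP/andP => [/set_mem Ax|[/asboolP Ax _]];
      [split; [exact/asboolP|exact: AN]|exact: mem_set].
  by apply: (sub_finite_set (B := `I_N)) => //; exact: finite_II.
rewrite card_fseq undup_id ?filter_uniq ?iota_uniq // size_filter -sum1_count.
by rewrite big_mkcond /= /index_iota subn0; apply: eq_bigr => i _; case: asboolP.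
Qed.

Lemma sum_nat_double (f : nat -> nat) (M : nat) :
  \sum_(0 <= i < M.*2) f i =
  \sum_(0 <= i < M) f i.*2 + \sum_(0 <= i < M) f i.*2.+1.
Proof.
elim: M => [|M IH]; first by rewrite !big_nil.
by rewrite doubleS !big_nat_recr //= IH; lia.
Qed.

(** * The conductor, and its relation to [frobenius] and [genus] *)

(** This is [F(S) + 1] as a natural number. The second clause is vacuous at [c = 0], which covers
    [S = nat] without a truncated predecessor. *)
Definition is_conductor (S : set nat) (c : nat) : Prop :=
  (forall x, c <= x -> S x) /\ (forall x, c = x.+1 -> ~ S x).

Lemma cofinite_cofinal (S : set nat) :
  finite_set (~` S) -> exists c, forall x, c <= x -> S x.
Proof.
move=> fS; exists (\max_(i <- fset_set (~` S)) i).+1 => x; apply: contraPP => nSx.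
have xS : x \in fset_set (~` S) by rewrite in_fset_set // mem_set.
by apply/negP; rewrite -leqNgt; exact: leq_bigmax_seq.
Qed.

Lemma conductor_exists (S : set nat) :
  finite_set (~` S) -> exists c, is_conductor S c.
Proof.
move=> /cofinite_cofinal cS.
have exP : exists c, `[< forall x, c <= x -> S x >].
  by have [c Hc] := cS; exists c; exact/asboolP.
case: (ex_minnP exP) => c /asboolP Hc cmin; exists c; split=> // x cE Sx.
suff /cmin : `[< forall y, x <= y -> S y >] by rewrite cE ltnn.
apply/asboolP => y; rewrite leq_eqVlt => /predU1P[<- //|xy].
by apply: Hc; rewrite cE.
Qed.

Lemma frobenius_conductor (S : set nat) (c : nat) :
  is_conductor S c -> frobenius S = (c%:Z - 1)%R.
Proof.
move=> [cS cN]; apply: xget_unique.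
  split.
    by move=> [x Sx xE]; apply: (cN x) => //; lia.
  move=> z nSz; apply: contrapT => /negP zc; apply: nSz.
  by exists `|z|%N; [apply: cS; lia|lia].
move=> z [nSz zub].
have : (c%:Z - 1 <= z)%R.
  by apply: zub => -[x Sx xE]; apply: (cN x) => //; lia.
suff : (z < c%:Z)%R by lia.
apply: contrapT => /negP cz; apply: nSz.
by exists `|z|%N; [apply: cS; lia|lia].
Qed.

Lemma genus_sum (S : set nat) (N : nat) :
  (forall x, N <= x -> S x) -> genus S = \sum_(0 <= i < N) `[< ~ S i >].
Proof.
move=> NS; apply: cardinality_sum => x nSx.
by rewrite ltnNge; apply/negP => /NS.
Qed.

(** Each number below [c] is either a gap or a small element, so the two indicators add up to 1. *)
Lemma genus_add_small_elements (S : set nat) (c : nat) :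
  is_conductor S c -> genus S + small_elements_number S = c.
Proof.
move=> Sc; have [cS cN] := Sc.
have -> : small_elements_number S = cardinality [set x | S x /\ x < c].
  rewrite /small_elements_number (frobenius_conductor S c Sc); congr cardinality.
  apply/seteqP; split=> x /= [Sx xc]; split=> //; first by lia.
  (* The bound [x < c] allows [x = F(S)], which is excluded because [F(S)] is a gap. *)
  by have : c <> x.+1 by [move=> /cN]; lia.
rewrite (genus_sum S c cS) (cardinality_sum _ c) => [|x []//].
rewrite -big_split /= big_nat_cond (eq_bigr (fun=> 1)) => [|i].
  by rewrite -big_nat_cond sum_nat_const_nat muln1 subn0.
move=> /andP[/andP[_ ic] _].
case: (pselect (S i)) => Si.
  by rewrite asboolF // asboolT.
by rewrite asboolT // asboolF // => -[].
Qed.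

(** * Irreducible elements and the embedding dimension *)

Definition irreducibles (S : set nat) : set nat :=
  [set a | [/\ S a, a <> 0 &
    forall x y, S x -> S y -> a = x + y -> x = 0 \/ y = 0]].

Lemma generated_irreducibles (S : set nat) :
  is_submonoid S -> generated (irreducibles S) = S.
Proof.
move=> mS; apply/seteqP; split; first by apply: smallest_sub => // a [].
move=> a; elim/ltn_ind: a => a IH Sa M [mM IM].
have [->|a0] := eqVneq a 0; first exact: mM.1.
case: (pselect (irreducibles S a)) => [/IM //|nirr].
have [x [y [Sx Sy aE x0 y0]]] :
    exists x y, [/\ S x, S y, a = x + y, x <> 0 & y <> 0].
  apply: contrapT => H; apply: nirr; split=> //; first exact/eqP.
  move=> x y Sx Sy aE; apply: contrapT => /not_orP[x0 y0].
  by apply: H; exists x, y.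
by rewrite aE; apply: mM.2; apply: IH => //; lia.
Qed.

(** Removing an irreducible [a] from [S] leaves a submonoid; if [A] missed [a], it would generate no
    more than that. *)
Lemma irreducibles_sub_generators (S A : set nat) :
  is_submonoid S -> system_of_generators S A -> irreducibles S `<=` A.
Proof.
move=> [S0 SD] gA a [Sa a0 airr]; apply: contrapT => nAa.
have AS : A `<=` S by rewrite -gA; exact: sub_gen_smallest.
suff : (S `\ a) a by case=> _ /(_ erefl).
have: generated A a by rewrite gA.
apply; split; last first.
  by move=> x Ax; split; [exact: AS|move=> xa; apply: nAa; rewrite -xa].
split; first by split=> // /esym.
move=> x y [Sx xa] [Sy ya]; split; first exact: SD.
move=> /= xya; have [x0|y0] := airr _ _ Sx Sy (esym xya).
  by apply: ya; rewrite -xya x0.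
by apply: xa; rewrite -xya y0 addn0.
Qed.

Lemma embedding_dimension_irreducibles (S : set nat) :
  is_submonoid S -> embedding_dimension S = cardinality (irreducibles S).
Proof.
move=> mS; congr cardinality; apply: xget_unique.
  split; first exact: generated_irreducibles.
  move=> B BI gB; apply/seteqP; split=> //.
  exact: irreducibles_sub_generators.
move=> A [gA minA]; apply/esym/minA; last exact: generated_irreducibles.
exact: irreducibles_sub_generators.
Qed.

Lemma finite_irreducibles (S : set nat) :
  finite_set (~` S) -> finite_set (irreducibles S).
Proof.
move=> /cofinite_cofinal[c cS].
apply: (sub_finite_set (B := `I_(c.+1.*2))); last exact: finite_II.
move=> a [Sa a0 airr] /=; rewrite ltnNge; apply/negP => ca.
(* A large [a] splits into two elements past [c]; taking [c.+1] keeps the first summand nonzero even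
   when [c = 0]. *)
have [||||] := airr c.+1 (a - c.+1); try lia; apply: cS; lia.
Qed.

Lemma embedding_dimension_gt0 (S : set nat) (s : nat) :
  numerical_semigroup S -> S s -> 0 < s -> 0 < embedding_dimension S.
Proof.
move=> [mS fS] Ss s0; rewrite embedding_dimension_irreducibles //.
rewrite /cardinality cardfs_gt0; apply/negP => /eqP.
rewrite -fset_set0 => /fset_set_inj irr0.
(* Without irreducibles, [S] would be generated by the empty set, hence be [[set 0]], against
   [0 < s]. *)
have : generated (irreducibles S) s by rewrite generated_irreducibles.
rewrite irr0 => [|//|]; [|exact: finite_irreducibles|exact: finite_set0].
move=> /(_ [set 0]); suff H : is_submonoid [set 0] /\ set0 `<=` [set 0].
  by move=> /(_ H) /= s00; move: s0; rewrite s00.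
by split=> //; split=> //= x y -> ->.
Qed.

(** * The semigroup [T], split by parity *)

Section doubling.

Variables (S : set nat) (s : nat).
Hypotheses (hS : numerical_semigroup S) (Ss : S s) (Ss1 : S s.+1).

Let T := dilate 2 S `|` sumset [set 2 * s + 1] (dilate 2 S).

Lemma doubling_even (m : nat) : T m.*2 <-> S m.
Proof.
split; last by move=> Sm; left; exists m => //; lia.
case=> [[x Sx xE]|[a -> [b [x Sx <-]]]]; last by lia.
by suff -> : m = x by []; lia.
Qed.

(** Write [2m + 1 = (2s + 1) + 2(m - s)]. The bound [s <= m] guards against truncation, since [S]
    contains 0. *)
Lemma doubling_odd (m : nat) : T m.*2.+1 <-> s <= m /\ S (m - s).
Proof.
split.
  case=> [[x Sx xE]|[a -> [b [x Sx <-]]]]; first by lia.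
  by move=> xE; split; [lia|suff -> : m - s = x by []; lia].
move=> [sm Sm]; right; exists (2 * s + 1) => //; exists (2 * (m - s)).
  by exists (m - s).
by lia.
Qed.

Lemma doubling_submonoid : is_submonoid T.
Proof.
have [[S0 SD] _] := hS.
split; first by rewrite -[0]/(0.*2); exact/doubling_even.
move=> x y; rewrite -(odd_double_half x) -(odd_double_half y).
case: (odd x); case: (odd y); rewrite ?add0n ?add1n.
- move=> /doubling_odd[sx Sx] /doubling_odd[sy Sy].
  (* Two odd elements contribute [2(2s + 1)], and [2s + 1 = s + (s + 1)] lies in [S]: here both [s]
     and [s + 1] being in [S] matter. *)
  rewrite (_ : _ + _ = (x./2 - s + (y./2 - s) + (s + s.+1)).*2); last by lia.
  exact/doubling_even/(SD _ _ (SD _ _ Sx Sy) (SD _ _ Ss Ss1)).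
- move=> /doubling_odd[sx Sx] /doubling_even Sy.
  rewrite (_ : _ + _ = (x./2 + y./2).*2.+1); last by lia.
  apply/doubling_odd; split; first by lia.
  by rewrite (_ : _ - _ = x./2 - s + y./2); [exact: SD|lia].
- move=> /doubling_even Sx /doubling_odd[sy Sy].
  rewrite (_ : _ + _ = (x./2 + y./2).*2.+1); last by lia.
  apply/doubling_odd; split; first by lia.
  by rewrite (_ : _ - _ = x./2 + (y./2 - s)); [exact: SD|lia].
- move=> /doubling_even Sx /doubling_even Sy.
  by rewrite -doubleD; apply/doubling_even; exact: SD.
Qed.

(** Odd membership is that of [S] shifted by [s], so the odd numbers of [T] settle last: the gap
    [c - 1] of [S] becomes the gap [2(c - 1 + s) + 1]. *)
Lemma doubling_conductor (c : nat) :
  is_conductor S c -> is_conductor T (c + s).*2.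
Proof.
move=> [cS cN]; split=> x; rewrite -(odd_double_half x).
  case: (odd x); rewrite ?add0n ?add1n => cx.
    by apply/doubling_odd; split; [lia|apply: cS; lia].
  by apply/doubling_even; apply: cS; lia.
case: (odd x); rewrite ?add0n ?add1n => cx; last by lia.
by move=> /doubling_odd[sx]; apply: cN; lia.
Qed.

Lemma doubling_numerical_semigroup : numerical_semigroup T.
Proof.
split; first exact: doubling_submonoid.
have [c /doubling_conductor[cT _]] := conductor_exists S hS.2.
apply: (sub_finite_set (B := `I_((c + s).*2))); last exact: finite_II.
by move=> x /= nTx; rewrite ltnNge; apply/negP => /cT.
Qed.

Lemma doubling_genus : genus T = 2 * genus S + s.
Proof.
have [c Sc] := conductor_exists S hS.2.
rewrite (genus_sum T (c + s).*2); last exact: (doubling_conductor c Sc).1.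
rewrite sum_nat_double mul2n -addnn -addnA; congr (_ + _).
  rewrite (genus_sum S (c + s)); last by move=> x cx; apply: Sc.1; lia.
  apply: eq_bigr => i _; congr (nat_of_bool _); apply: asbool_equiv_eq.
  by split=> nS /doubling_even.
(* The [s] odd numbers below [2s + 1] are all gaps; from index [s] on, the sum is the gap count of
   [S] shifted by [s]. *)
rewrite (genus_sum S c Sc.1) [RHS]addnC (big_cat_nat (n := s)) ?leq_addl //=.
congr (_ + _); last first.
  rewrite -{1}[s]add0n big_addn addnK; apply: eq_bigr => i _.
  congr (nat_of_bool _); apply: asbool_equiv_eq.
  split=> nS; first by move=> Si; apply: nS; apply/doubling_odd; rewrite addnK leq_addl.
  by move=> /doubling_odd[_]; rewrite addnK.
rewrite big_nat_cond (eq_bigr (fun=> 1)) => [|i /andP[/andP[_ is_] _]].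
  by rewrite -big_nat_cond sum_nat_const_nat muln1 subn0.
by rewrite asboolT // => /doubling_odd[]; lia.
Qed.

Lemma doubling_small_elements_number :
  small_elements_number T = 2 * small_elements_number S + s.
Proof.
have [c Sc] := conductor_exists S hS.2.
have := genus_add_small_elements T _ (doubling_conductor c Sc).
by have := genus_add_small_elements S c Sc; rewrite doubling_genus; lia.
Qed.

(** This is the least odd element of [T], and any decomposition of it has an odd summand. *)
Lemma doubling_irreducible_odd : irreducibles T s.*2.+1.
Proof.
have [[S0 _] _] := hS.
split=> //; first by apply/doubling_odd; rewrite subnn.
move=> x y; rewrite -(odd_double_half x) -(odd_double_half y).
case: (odd x); case: (odd y); rewrite ?add0n ?add1n.
- by lia.
- by move=> /doubling_odd[]; lia.
- by move=> _ /doubling_odd[]; lia.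
- by lia.
Qed.

Lemma doubling_irreducible_even (a : nat) :
  0 < s -> irreducibles S a -> irreducibles T a.*2.
Proof.
have [[_ SD] _] := hS.
move=> s0 [Sa a0 airr]; split; [exact/doubling_even|by lia|].
move=> x y; rewrite -(odd_double_half x) -(odd_double_half y).
case: (odd x); case: (odd y); rewrite ?add0n ?add1n; try lia.
- move=> /doubling_odd[sx Sx] /doubling_odd[sy Sy] aE.
  (* Two odd summands of [2a] would give a splitting of [a] in [S]; the shares [s] and [s + 1] make
     both parts nonzero, as [0 < s]. *)
  have := airr (x./2 - s + s) (y./2 - s + s.+1).
  by case; [exact: SD|exact: SD|lia|lia|lia].
- move=> /doubling_even Sx /doubling_even Sy aE.
  by have := airr _ _ Sx Sy; case; lia.
Qed.

Lemma doubling_embedding_dimension :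
  0 < s -> embedding_dimension S < embedding_dimension T.
Proof.
move=> s0; have [mT fT] := doubling_numerical_semigroup; have [mS fS] := hS.
rewrite !embedding_dimension_irreducibles // /cardinality.
pose D := [fset x.*2 | x in fset_set (irreducibles S)]%fset.
have <- : #|` D|%fset = #|` fset_set (irreducibles S)|%fset.
  by apply: card_imfset; exact: double_inj.
have sD : s.*2.+1 \notin D by apply/negP => /imfsetP[x _]; lia.
have <- : #|` (s.*2.+1 |` D)|%fset = (#|` D|%fset).+1 by rewrite cardfsU1 sD.
have fI := finite_irreducibles.
apply/fsubset_leq_card/fsubsetP => x; rewrite !inE => /predU1P[->|].
  by rewrite in_fset_set ?mem_set; auto; exact: doubling_irreducible_odd.
move=> /imfsetP[a /= aS ->]; move: aS; rewrite !in_fset_set; auto.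
by move=> /set_mem aS; apply/mem_set/doubling_irreducible_even.
Qed.

Lemma doubling_wilf : 0 < s -> wilf S -> wilf T.
Proof.
move=> s0; rewrite /wilf doubling_genus doubling_small_elements_number.
have := doubling_embedding_dimension s0.
(* Positivity of [e(S)] gives [s <= e(S) s] in the final inequality. *)
have := embedding_dimension_gt0 S s hS Ss s0.
by nia.
Qed.

End doubling.

Theorem proposition50 (S : set nat) (hS : numerical_semigroup S)
    (s : nat) (hs : [set s; s.+1] `<=` S)
    (T : set nat) (hT : T = dilate 2 S `|` sumset [set 2 * s + 1] (dilate 2 S)) :
  wilf S -> wilf T.
Proof.
have Ss : S s by apply: hs; left.
have Ss1 : S s.+1 by apply: hs; right.
(* At [s = 0] doubles may become reducible ([2 = 1 + 1]), so this case is separate: [1] in [S]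
   forces [S], and then [T], to be all of [nat]. *)
case: (posnP s) => [s0|s_gt0]; last by rewrite hT; exact: doubling_wilf.
have ST x : S x.
  elim: x => [|x Sx]; first exact: hS.1.1.
  by rewrite -addn1; apply: hS.1.2 => //; rewrite s0 in Ss1.
suff -> : T = S by [].
apply/seteqP; split=> // x _; rewrite hT -(odd_double_half x).
case: (odd x); rewrite ?add0n ?add1n.
  by apply/doubling_odd; rewrite s0.
exact/doubling_even.
Qed.
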